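(* Let $r\ge 1$, $m\in\{1,\dots,r\}$ and $n\ge m$ be integers. Let $I,J\subseteq\{1,\dots,r\}$ with $|I|=|J|=m$. If $W\sim\mathcal{W}_r(n,I_r)$, then $$\mathrm{E}[\det(W_{I\times J})]=\begin{cases} n!/(n-m)!, & \text{if } I=J,\\ 0, & \text{otherwise.}\end{cases}$$ Moreover, if $\Sigma\in\mathbb{R}^{r\times r}$ is symmetric positive definite and $S\sim\mathcal{W}_r(n,\Sigma)$, then $$\mathrm{E}[S^{(m)}]=\frac{n!}{(n-m)!}\,\Sigma^{(m)}.$$
   Context: The Wishart distribution $\mathcal{W}_r(n,\Sigma)$ is the law of $XX^T$, where $X\in\mathbb{R}^{r\times n}$ has independent columns each distributed as $\mathcal{N}_r(0,\Sigma)$; $I_r$ is the identity matrix. $A_{I\times J}$ denotes the submatrix of $A$ with row indices in $I$ and column indices in $J$ (index sets listed in a fixed order, e.g. increasing). The $m$th compound $A^{(m)}$ of $A\in\mathbb{R}^{r\times r}$ is the $\binom{r}{m}\times\binom{r}{m}$ matrix $(\det(A_{I\times J}))_{I,J}$ indexed by the $m$-element subsets $I,J$ of $\{1,\dots,r\}$. Expectations of matrices are entrywise. *)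

(* Defs.v *)
From HB Require Import structures.
From mathcomp Require Import all_boot all_order all_algebra.
From mathcomp Require Import all_classical all_reals all_analysis.

Set Implicit Arguments.
Unset Strict Implicit.
Unset Printing Implicit Defensive.

Import Order.TTheory GRing.Theory Num.Theory.
Import numFieldNormedType.Exports.

Local Open Scope classical_set_scope.
Local Open Scope ring_scope.

Definition msubset (r m : nat) := {I : {set 'I_r} | #|I| == m}.

Lemma card_msubset (r m : nat) : #|{: msubset r m}| = 'C(r, m).
Proof.
rewrite card_sig -[in RHS](card_ord r) -card_draws.
by apply: eq_card => I; rewrite !inE.
Qed.

(* The i-th element of I in increasing order: [enum_val] follows the
   enumeration of ['I_r]. *)
Definition msubset_nth (r m : nat) (I : msubset r m) (i : 'I_m) : 'I_r :=
  enum_val (cast_ord (esym (eqP (valP I))) i).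

Definition msubmx (R : Type) (r m : nat) (A : 'M[R]_r) (I J : msubset r m) :
  'M[R]_m := mxsub (msubset_nth I) (msubset_nth J) A.

Definition compound (R : comPzRingType) (r m : nat) (A : 'M[R]_r) :
    'M[R]_('C(r, m)) :=
  let nth_subset (k : 'I_('C(r, m))) : msubset r m :=
    enum_val (cast_ord (esym (card_msubset r m)) k) in
  \matrix_(k, l) \det (msubmx A (nth_subset k) (nth_subset l)).

Definition quad_form (R : pzRingType) (r : nat) (A : 'M[R]_r) (x : 'cV[R]_r) :
  R := (x^T *m A *m x) ord0 ord0.

Definition sym_posdef (R : numDomainType) (r : nat) (A : 'M[R]_r) : Prop :=
  A^T = A /\ forall x : 'cV[R]_r, x != 0 -> 0 < quad_form A x.

(* The sigma-algebra on matrices generated by the entries (for real matrices,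
   the Borel sigma-algebra). *)

Definition measure_matrix_display : measure_display -> measure_display.
Proof. exact. Qed.

Section measurable_matrix.
Context (d : measure_display) (T : measurableType d) (p q : nat).

Let entries : set (set 'M[T]_(p, q)) :=
  \bigcup_(ij in [set: 'I_p * 'I_q])
    preimage_set_system setT (fun M : 'M[T]_(p, q) => M ij.1 ij.2) measurable.

Let matrix_set0 : <<s entries >> set0.
Proof. exact: sigma_algebra0. Qed.

Let matrix_setC A : <<s entries >> A -> <<s entries >> (~` A).
Proof. exact: sigma_algebraC. Qed.

Let matrix_bigcup (F : (set 'M[T]_(p, q))^nat) :
  (forall i, <<s entries >> (F i)) -> <<s entries >> (\bigcup_i F i).
Proof. exact: sigma_algebra_bigcup. Qed.

HB.instance Definition _ := @isMeasurable.Build (measure_matrix_display d)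
  'M[T]_(p, q) <<s entries >> matrix_set0 matrix_setC matrix_bigcup.

End measurable_matrix.

Section random_matrices.
Context (d : measure_display) (T : measurableType d) (R : realType).
Variable P : probability T R.
Local Open Scope ereal_scope.

(* Entrywise; the entries are extended reals, so an equality with a real
   matrix also asserts the integrability of each (measurable) entry. *)
Definition expectation_mx (p q : nat) (X : T -> 'M[R]_(p, q)) :
  'M[\bar R]_(p, q) := \matrix_(i, j) 'E_P[fun w => X w i j].

Definition mutually_independent (d' : measure_display) (T' : measurableType d')
    (n : nat) (X : 'I_n -> T -> T') : Prop :=
  forall B : 'I_n -> set T', (forall k, measurable (B k)) ->
  P (\bigcap_(k in [set: 'I_n]) X k @^-1` B k) =
  \prod_(k < n) P (X k @^-1` B k).

(* The law N(0, v), including the point mass N(0, 0). The test is needed since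
   [normal_prob 0 0] is the uniform law on [0, 1] by convention. *)
Definition centered_normal (v : R) : set R -> \bar R :=
  if v == 0%R then dirac (0%R : R) else normal_prob 0 (Num.sqrt v).

(* N_r(0, Sigma) through the laws of linear forms, so that no density is needed
   and singular Sigma is allowed; meaningful for Sigma symmetric positive
   semidefinite. *)
Definition mvnormal (r : nat) (Sigma : 'M[R]_r) (X : T -> 'cV[R]_r) : Prop :=
  forall (a : 'cV[R]_r) (B : set R), measurable B ->
  pushforward P (fun w => (a^T *m X w)%R ord0 ord0) B =
  centered_normal (quad_form Sigma a) B.

End random_matrices.

(* The space carrying X need not be the one on which a random matrix with law
   mu lives. *)
Definition wishart (R : realType) (r n : nat) (Sigma : 'M[R]_r)
    (mu : set 'M[R]_r -> \bar R) : Prop :=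
  exists (d : measure_display) (T : measurableType d) (P : probability T R)
         (X : {RV P >-> 'M[R]_(r, n)}),
  [/\ mutually_independent P (fun (k : 'I_n) w => col k (X w)),
      forall k : 'I_n, mvnormal P Sigma (fun w => col k (X w))
    & forall B : set 'M[R]_r, measurable B ->
        mu B = pushforward P (fun w => X w *m (X w)^T) B].

(* Main.v *)
Require Import Defs.
From HB Require Import structures.
From mathcomp Require Import all_boot all_order all_algebra.
From mathcomp Require Import all_classical all_reals all_analysis.
From mathcomp Require Import perm measurable_realfun ring.

Set Implicit Arguments.
Unset Strict Implicit.
Unset Printing Implicit Defensive.

Import Order.TTheory GRing.Theory Num.Theory.
Import numFieldNormedType.Exports.

Local Open Scope classical_set_scope.
Local Open Scope ring_scope.

(** Both formulas are instances of one identity for the Gram matrix of a random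
    matrix X whose n columns are independent N_r(0, Sigma):
    E[det((X X^T)_{I x J})] = n (n-1) ... (n-m+1) * det(Sigma_{I x J}).

    Expand the determinant of A B^T, where A and B are the m x n matrices of the
    rows of X selected by I and J. Distributing the products of sums over
    columns gives one term for each map f from rows to columns and each
    permutation s, namely sgn(s) times the product over i of
    A(i, f i) B(s i, f i). For a non-injective f the sum over s is a multiple
    of a determinant with two equal rows, hence vanishes
    ([det_mulmx_trmx]). For an injective f the factors involve distinct,
    hence independent, columns of X, so the expectation factors
    ([independent_prod]) into the covariances Sigma(I i, J (s i))
    ([mvnormal_covariance]), and summing over s rebuilds det(Sigma_{I x J}),
    whatever f is. There are n!/(n-m)! injective maps, which gives
    [has_mean_minor_gram].

    A Wishart matrix has the law of X X^T, possibly on another probability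
    space; [integral_eq_law] moves the expectation there. For Sigma = I_r the
    minor det(Sigma_{I x J}) is 1 if I = J and has a zero row otherwise.

    The probabilistic input is built up from the definitions. Expectations of
    products of independent variables are computed by replacing, one factor at
    a time, indicators by general functions. The covariances come from the
    variance of the one-dimensional normal law, obtained by an integration by
    parts, applied to linear forms of the columns and polarized. *)

(** * Integrals under a change of measure *)

Section density.
Local Open Scope ereal_scope.
Context d d' (T : measurableType d) (T' : measurableType d') (R : realType).
Variables (mu : {measure set T -> \bar R}) (nu : {measure set T' -> \bar R}).
Variables (phi : T -> T') (h : T -> R).
Hypotheses (mphi : measurable_fun setT phi) (mh : measurable_fun setT h).
Hypothesis h0 : forall x, (0 <= h x)%R.
Hypothesis nuE : forall B, measurable B ->
  \int[mu]_(x in phi @^-1` B) (h x)%:E = nu B.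

Import HBNNSimple.

(* On the level set of a simple function over the value r, both sides reduce to
   r * nu(level set) by the hypothesis on nu. *)
Let integral_density_nnsfun (g : {nnsfun T' >-> R}) :
  \int[mu]_x (g (phi x) * h x)%:E = \int[nu]_y (g y)%:E.
Proof.
have mpre r : measurable (g @^-1` [set r]).
  by rewrite -[X in measurable X]setTI; exact: measurable_funP.
have mpre' r : measurable (phi @^-1` (g @^-1` [set r])).
  by rewrite -[X in measurable X]setTI; exact: mphi.
under [RHS]eq_integral do rewrite fimfunE -fsumEFin//.
rewrite ge0_integral_fsum//; last 2 first.
- by move=> r; exact/measurable_EFinP/measurable_funM.
- by move=> r y _; rewrite nnfun_muleindic_ge0.
have gE x : (g (phi x) * h x)%:E = \sum_(r \in range g)
    (r * \1_(g @^-1` [set r]) (phi x) * h x)%:E.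
  by rewrite fsumEFin// -mulr_fsuml// -fimfunE.
under eq_integral do rewrite gE.
rewrite ge0_integral_fsum//; last 2 first.
- move=> r; apply/measurable_EFinP/measurable_funM => //.
  apply: measurable_funM => //.
  exact: (measurableT_comp (measurable_indic (mpre r)) mphi).
- move=> r x _; rewrite EFinM mule_ge0 ?lee_fin//.
  by rewrite -lee_fin EFinM nnfun_muleindic_ge0.
apply: eq_fsbigr => r _.
rewrite integralZl_indic_nnsfun// integral_indic// setIT -nuE//.
rewrite [in RHS]integral_mkcond.
(* A negative r is not a value of g, so its level set is empty. *)
have [r0|r0] := ltP r 0%R.
  rewrite preimage_nnfun0// preimage_set0 !integral0_eq ?mule0//.
    by move=> x _; rewrite patchE in_set0.
  by move=> x _; rewrite indicE in_set0 mulr0 mul0r.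
rewrite -ge0_integralZl//; last 2 first.
- apply/(measurable_restrictT _ _).1 => //.
  by apply/measurable_funTS/measurable_EFinP.
- by move=> x _; rewrite patchE; case: ifP => // _; rewrite lee_fin.
apply: eq_integral => x _; rewrite patchE indicE.
have -> : (x \in phi @^-1` (g @^-1` [set r])) = (phi x \in g @^-1` [set r]).
  by apply/idP/idP; rewrite !inE.
by case: ifP => _; rewrite ?mulr1 ?mulr0 ?mul0r ?mule0 ?EFinM.
Qed.

(** The hypothesis on [nu] is the conclusion for indicators g; it extends to
    simple functions by linearity and to all nonnegative functions by monotone
    convergence. With phi = id this integrates against a law with density h;
    with nu equal to c times the law of phi, it factors the integral of g(phi) h
    into c times that of g(phi). *)
Lemma ge0_integral_density (g : T' -> R) : measurable_fun setT g ->
  (forall y, (0 <= g y)%R) ->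
  \int[mu]_x (g (phi x) * h x)%:E = \int[nu]_y (g y)%:E.
Proof.
move=> mg g0.
have mg' : measurable_fun setT (EFin \o g) by exact/measurable_EFinP.
pose g_ := nnsfun_approx measurableT mg'.
have cvg_g y : (g_ n y)%:E @[n --> \oo] --> (g y)%:E.
  by apply: (cvg_nnsfun_approx measurableT mg') => // x _; rewrite lee_fin.
have nd_g y : {homo (fun n => g_ n y) : m n / (m <= n)%N >-> (m <= n)%R}.
  by move=> m n mn; exact/lefP/nd_nnsfun_approx.
transitivity (limn (fun n => \int[nu]_y (g_ n y)%:E)); last first.
  rewrite -monotone_convergence//.
  - by apply: eq_integral => y _; apply/cvg_lim => //; exact: cvg_g.
  - by move=> n; exact/measurable_EFinP/measurable_funP.
  - by move=> n y _; rewrite lee_fin.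
  - by move=> y _ m n mn; rewrite lee_fin; exact: nd_g.
rewrite -(_ : (fun n => \int[mu]_x (g_ n (phi x) * h x)%:E) =
    (fun n => \int[nu]_y (g_ n y)%:E)); last first.
  by apply/funext => n; exact: integral_density_nnsfun.
rewrite -monotone_convergence//.
- apply: eq_integral => x _; apply/esym/cvg_lim => //.
  under eq_fun do rewrite EFinM; rewrite EFinM.
  exact: cvgeZr.
- move=> n; apply/measurable_EFinP/measurable_funM => //.
  exact: (measurableT_comp (measurable_funPT (g_ n)) mphi).
- by move=> n x _; rewrite lee_fin mulr_ge0.
- by move=> x _ m n mn; rewrite lee_fin ler_wpM2r//; exact: nd_g.
Qed.

End density.

(** The positive and negative parts of f are nonnegative, hence integrate as their
    image measures, which agree; recombining them is the definition of the
    integral of f. *)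
Lemma integral_eq_law d1 d2 d' (T1 : measurableType d1) (T2 : measurableType d2)
    (T' : measurableType d') (R : realType)
    (mu1 : {measure set T1 -> \bar R}) (mu2 : {measure set T2 -> \bar R})
    (X1 : T1 -> T') (X2 : T2 -> T') (f : T' -> \bar R) :
  measurable_fun setT X1 -> measurable_fun setT X2 -> measurable_fun setT f ->
  (forall B, measurable B -> mu1 (X1 @^-1` B) = mu2 (X2 @^-1` B)) ->
  (\int[mu1]_w f (X1 w) = \int[mu2]_w f (X2 w))%E.
Proof.
move=> mX1 mX2 mf eqB.
have ge0_eq (g : T' -> \bar R) : measurable_fun setT g ->
    (forall y, 0 <= g y)%E ->
    (\int[mu1]_w g (X1 w) = \int[mu2]_w g (X2 w))%E.
  move=> mg g0.
  transitivity (\int[pushforward mu1 X1]_y g y)%E.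
    by rewrite ge0_integral_pushforward.
  transitivity (\int[pushforward mu2 X2]_y g y)%E.
    by apply: eq_measure_integral => B mB _; exact: eqB.
  by rewrite ge0_integral_pushforward.
rewrite integralE [RHS]integralE; congr (_ - _)%E.
- rewrite (funepos_comp f X1) (funepos_comp f X2).
  by apply: ge0_eq; [exact: measurable_funepos|exact: funepos_ge0].
- rewrite (funeneg_comp f X1) (funeneg_comp f X2).
  by apply: ge0_eq; [exact: measurable_funeneg|exact: funeneg_ge0].
Qed.

(** * Finite means *)

Section mean.
Context d (T : measurableType d) (R : realType) (P : probability T R).

(** Carrying the integrability along with the value makes the notion closed under
    linear combinations, which the bare integral is not. *)
Definition has_mean (f : T -> R) (e : R) : Prop :=
  P.-integrable setT (EFin \o f) /\ (\int[P]_w (f w)%:E = e%:E)%E.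

Lemma ge0_has_mean (f : T -> R) (e : R) : measurable_fun setT f ->
  (forall w, 0 <= f w) -> (\int[P]_w (f w)%:E = e%:E)%E -> has_mean f e.
Proof.
move=> mf f0 fe; split => //; apply/integrableP; split.
  exact/measurable_EFinP.
by under eq_integral do rewrite /= ger0_norm//; rewrite fe ltry.
Qed.

Lemma has_meanZ (c : R) (f : T -> R) (e : R) :
  has_mean f e -> has_mean (fun w => c * f w) (c * e).
Proof.
move=> [fi fe]; split.
  by rewrite (_ : _ \o _ = (fun w => c%:E * (f w)%:E)%E)//; exact: integrableZl.
under eq_integral do rewrite EFinM.
by rewrite integralZl// fe EFinM.
Qed.

Lemma has_mean_cst (c : R) : has_mean (cst c) c.
Proof.
split.
  exact: finite_measure_integrable_cst.
rewrite (integral_cst P measurableT c%:E) [X in (_ * X)%E](_ : _ = 1%E) ?mule1//.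
exact: probability_setT.
Qed.

Lemma has_meanD (f1 f2 : T -> R) (e1 e2 : R) :
  has_mean f1 e1 -> has_mean f2 e2 ->
  has_mean (fun w => f1 w + f2 w) (e1 + e2).
Proof.
move=> [i1 m1] [i2 m2]; split.
  by rewrite (_ : _ \o _ = (fun w => (f1 w)%:E + (f2 w)%:E)%E)//; exact: integrableD.
under eq_integral do rewrite EFinD.
by rewrite integralD// m1 m2 EFinD.
Qed.

Lemma has_mean_sum (I : Type) (s : seq I) (p : pred I) (f : I -> T -> R)
    (e : I -> R) : (forall i, p i -> has_mean (f i) (e i)) ->
  has_mean (fun w => \sum_(i <- s | p i) f i w) (\sum_(i <- s | p i) e i).
Proof.
move=> fe; elim: s => [|i s IH].
  by rewrite big_nil; under eq_fun do rewrite big_nil; exact: has_mean_cst.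
rewrite big_cons; under eq_fun do rewrite big_cons.
by case: ifPn => // pi; apply: has_meanD => //; exact: fe.
Qed.

End mean.


(** * Products of independent variables *)

Section independence.
Context d (T : measurableType d) (R : realType) (P : probability T R).
Context d' (T' : measurableType d') (n : nat).
Variable X : 'I_n -> T -> T'.
Hypothesis mX : forall k, measurable_fun setT (X k).
Hypothesis indX : mutually_independent P X.

Lemma indic_preimage (A : set T') (k : 'I_n) w :
  \1_A (X k w) = \1_(X k @^-1` A) w :> R.
Proof.
by rewrite !indicE; congr (nat_of_bool _)%:R; apply/idP/idP; rewrite !inE.
Qed.

Let mpre k B : measurable B -> measurable (X k @^-1` B).
Proof. by move=> mB; rewrite -[X in measurable X]setTI; exact: mX. Qed.

Lemma independent_indic_prod (B : 'I_n -> set T') :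
  (forall k, measurable (B k)) ->
  (\int[P]_w (\prod_k \1_(B k) (X k w))%:E =
   \prod_k P (X k @^-1` B k))%E.
Proof.
move=> mB; rewrite -indX//.
rewrite -[in RHS](setIT (\bigcap_(_ in _) _)) -integral_indic//; last first.
  by apply: fin_bigcap_measurable => // k _; exact: mpre.
apply: eq_integral => w _; congr EFin.
under eq_bigr do rewrite indic_preimage.
rewrite [RHS]indicE; have [Bw|nBw] := boolP (w \in _).
  by rewrite big1// => k _; rewrite indicE mem_set//; move: Bw; rewrite inE; exact.
suff [k nk] : exists k, ~ (X k @^-1` B k) w.
  by rewrite (bigD1 k)//= indicE memNset// mul0r.
apply: contrapT => /forallNP all; move/negP: nBw; apply; rewrite inE => k _.
by apply: contrapT; exact: all.
Qed.

(** By induction on j, the factors of index at least j being still indicators.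
    At the step, fixing all factors but the j-th one defines a set function
    B |-> E[1_B(X_j) * other factors] which, by induction, is a multiple of the
    law of X_j; [ge0_integral_density] then replaces the indicator 1_B by g_j. *)
Lemma independent_ge0_prod (g : 'I_n -> T' -> R) (e : 'I_n -> R) :
  (forall k, measurable_fun setT (g k)) -> (forall k y, 0 <= g k y) ->
  (forall k, \int[P]_w (g k (X k w))%:E = (e k)%:E)%E ->
  (\int[P]_w (\prod_k g k (X k w))%:E = (\prod_k e k)%:E)%E.
Proof.
suff S j : forall (g : 'I_n -> T' -> R) (e : 'I_n -> R),
    (forall k, measurable_fun setT (g k)) -> (forall k y, 0 <= g k y) ->
    (forall k, \int[P]_w (g k (X k w))%:E = (e k)%:E)%E ->
    (forall k : 'I_n, (j <= k)%N -> exists2 B, measurable B & g k = \1_B) ->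
    (\int[P]_w (\prod_k g k (X k w))%:E = (\prod_k e k)%:E)%E.
  move=> mg g0 ge; apply: (S n) => // k.
  by rewrite leqNgt ltn_ord.
elim: j => [|j IH] {}g {}e mg g0 ge gB.
  have /choice[B mB] : forall k, exists B, measurable B /\ g k = \1_B.
    by move=> k; have [//|B mB gkB] := gB k; exists B.
  have gE k w : g k (X k w) = \1_(B k) (X k w) by rewrite (mB k).2.
  under eq_integral => w _ do under eq_bigr do rewrite gE.
  rewrite independent_indic_prod; last by move=> k; exact: (mB k).1.
  rewrite -prodEFin; apply: eq_bigr => k _; rewrite -ge.
  under eq_integral do rewrite gE indic_preimage.
  by rewrite integral_indic ?setIT//; apply: mpre; exact: (mB k).1.
have [ltjn|lenj] := ltnP j n; last first.
  apply: IH => // k /(leq_trans lenj).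
  by rewrite leqNgt ltn_ord.
pose k0 := Ordinal ltjn.
have e0 k : 0 <= e k.
  by rewrite -lee_fin -ge; apply: integral_ge0 => w _; rewrite lee_fin.
have c0 : 0 <= \prod_(k | k != k0) e k by apply: prodr_ge0.
pose c : {nonneg R} := NngNum c0.
pose X0 : {mfun T >-> T'} := HB.pack (X k0)
  (isMeasurableFun.Build _ _ _ _ _ (mX k0)).
under eq_integral do rewrite (bigD1 k0)//=.
rewrite (bigD1 k0)//= mulrC.
rewrite (@ge0_integral_density _ _ _ _ _ P (mscale c (distribution P X0)))//.
- rewrite ge0_integral_mscale//=; last 2 first.
  + exact/measurable_EFinP.
  + by move=> y _; rewrite lee_fin.
  rewrite ge0_integral_distribution//; last 2 first.
  + exact/measurable_EFinP.
  + by move=> y; rewrite lee_fin.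
  by rewrite [X in (_ * X)%E](ge k0) EFinM.
- rewrite (_ : (fun w => _) = (fun w => \prod_k
      (if k != k0 then g k (X k w) else 1))); last first.
    by apply/funext => w; rewrite [LHS]big_mkcond.
  apply: measurable_prod => k _; case: (k != k0) => //.
  exact: (measurableT_comp (mg k) (mX k)).
- by move=> w; apply: prodr_ge0.
move=> B mB.
pose g' k := if k == k0 then \1_B else g k.
pose e' k := if k == k0 then fine (P (X k0 @^-1` B)) else e k.
have := IH g' e'.
rewrite [in X in _ -> _ -> _ -> _ -> _ = X](bigD1 k0)//= {2}/e' eqxx.
rewrite (eq_bigr e); last by move=> k /negPf nk; rewrite /e' nk.
move=> IH'; rewrite /mscale/= /distribution /pushforward /=.
rewrite muleC -[in RHS](@fineK _ (P _)) ?fin_num_measure//; last exact: mpre.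
rewrite -EFinM -IH'.
- rewrite integral_mkcond; apply: eq_integral => w _.
  rewrite (bigD1 k0)//= {1}/g' eqxx indic_preimage patchE indicE.
  rewrite [in RHS](eq_bigr (fun k => g k (X k w))); last first.
    by move=> k /negPf nk; rewrite /g' nk.
  by case: ifP => _; rewrite ?mul1r ?mul0r.
- by move=> k; rewrite /g'; case: ifP => _; [exact: measurable_indic|].
- by move=> k y; rewrite /g'; case: ifP.
- move=> k; rewrite /g' /e'; case: ifP => [/eqP->|_]; last exact: ge.
  under eq_integral do rewrite indic_preimage.
  rewrite integral_indic ?setIT//; last exact: mpre.
  by rewrite fineK// fin_num_measure//; exact: mpre.
- move=> k; rewrite /g'; case: ifP => [_ _|/eqP nk jk]; first by exists B.
  apply: gB; rewrite ltn_neqAle jk andbT; apply/eqP => jk'.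
  by apply: nk; apply: val_inj.
Qed.

(** Writing each factor as the difference of its positive and negative parts and
    distributing turns the product into a signed sum of 2^n products of
    nonnegative functions. *)
Lemma independent_prod (g : 'I_n -> T' -> R) (e : 'I_n -> R) :
  (forall k, measurable_fun setT (g k)) ->
  (forall k, has_mean P (fun w => g k (X k w)) (e k)) ->
  has_mean P (fun w => \prod_k g k (X k w)) (\prod_k e k).
Proof.
move=> mg ge.
pose gs k (b : bool) : T' -> R := if b then (g k)^\+ else (g k)^\-.
pose sg (b : bool) : R := if b then 1 else -1.
have mgs k b : measurable_fun setT (gs k b).
  by case: b; [exact: measurable_funrpos|exact: measurable_funrneg].
have gs0 k b y : 0 <= gs k b y.
  by case: b; [exact: funrpos_ge0|exact: funrneg_ge0].
have gE k y : g k y = \sum_(b : bool) sg b * gs k b y.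
  by rewrite big_bool/= mul1r mulN1r -[in LHS](funrposBneg (g k)).
pose es k b := fine (\int[P]_w (gs k b (X k w))%:E).
have esE k b : (\int[P]_w (gs k b (X k w))%:E = (es k b)%:E)%E.
  rewrite fineK//.
  apply: integrable_fin_num => //; case: b.
  - exact: (integrable_funrpos _ (ge k).1).
  - exact: (integrable_funrneg _ (ge k).1).
have eE k : e k = \sum_(b : bool) sg b * es k b.
  have [_ H] : has_mean P (fun w => \sum_(b : bool) sg b * gs k b (X k w))
      (\sum_(b : bool) sg b * es k b).
    apply: has_mean_sum => b _; apply: has_meanZ; apply: ge0_has_mean => //.
    exact: (measurableT_comp (mgs k b) (mX k)).
  apply: EFin_inj; rewrite -H -(ge k).2.
  by apply: eq_integral => w _; rewrite gE.
have -> : \prod_k e k = \sum_(t : {ffun 'I_n -> bool})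
    (\prod_k sg (t k)) * \prod_k es k (t k).
  under eq_bigr do rewrite eE.
  by rewrite bigA_distr_bigA; apply: eq_bigr => t _; rewrite big_split.
rewrite (_ : (fun w => _) = (fun w => \sum_(t : {ffun 'I_n -> bool})
    (\prod_k sg (t k)) * \prod_k gs k (t k) (X k w))); last first.
  apply/funext => w; under eq_bigr do rewrite gE.
  by rewrite bigA_distr_bigA; apply: eq_bigr => t _; rewrite big_split.
apply: has_mean_sum => t _; apply: has_meanZ; apply: ge0_has_mean.
- apply: measurable_prod => k _.
  exact: (measurableT_comp (mgs k (t k)) (mX k)).
- by move=> w; apply: prodr_ge0.
- apply: (independent_ge0_prod (g := fun k => gs k (t k))) => [k|k y|k].
  + exact: mgs.
  + exact: gs0.
  + exact: esE.
Qed.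

End independence.

(** * The variance of the normal law *)

Section normal_second_moment.
Context {R : realType}.
Variable s : R.
Hypothesis s0 : s != 0.
Local Notation mu := (@lebesgue_measure R).
Local Notation pdf := (normal_pdf 0 s).

Let s20 : 0 < s ^+ 2. Proof. by rewrite exprn_even_gt0. Qed.

Lemma normal_pdf0E (x : R) :
  pdf x = normal_peak s * expR (- (x ^+ 2) / (s ^+ 2 *+ 2)).
Proof. by rewrite normal_pdfE// /normal_fun subr0. Qed.

Lemma is_derive_normal_pdf (x : R) :
  is_derive x 1 pdf (- (x / s ^+ 2) * pdf x).
Proof.
rewrite (_ : pdf = fun x => normal_peak s * expR (- (x ^+ 2) / (s ^+ 2 *+ 2))).
  apply: is_derive_eq.
  by rewrite /GRing.scale/=; field.
by apply/funext => y; exact: normal_pdf0E.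
Qed.

(** The boundary term of the integration by parts. From exp(-t) <= 1/t for
    t = n^2 / (2 s^2), it is bounded by a constant over n. *)
Lemma normal_pdf_tail : n%:R * pdf n%:R @[n --> \oo] --> 0.
Proof.
pose c := normal_peak s * (s ^+ 2 *+ 2).
apply: (@squeeze_cvgr _ _ _ _ (fun=> 0) (fun n => c * n%:R^-1)).
- near=> n.
  have n0 : 0 < n%:R :> R by rewrite ltr0n; near: n; exact: nbhs_infty_gt.
  rewrite mulr_ge0 ?normal_pdf_ge0//=.
  rewrite normal_pdf0E mulrCA /c -mulrA ler_wpM2l ?normal_peak_ge0//.
  have t0 : 0 < n%:R ^+ 2 / (s ^+ 2 *+ 2) :> R.
    by rewrite divr_gt0 ?exprn_gt0// pmulrn_lgt0.
  rewrite mulNr expRN.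
  rewrite (@le_trans _ _ (n%:R * (n%:R ^+ 2 / (s ^+ 2 *+ 2))^-1))//.
    rewrite ler_wpM2l// lef_pV2 ?posrE ?expR_gt0//.
    by rewrite (le_trans _ (expR_ge1Dx _))// lerDr.
  rewrite [leLHS](_ : _ = s ^+ 2 *+ 2 / n%:R)//; field.
  by rewrite s0 gt_eqF.
- exact: cvg_cst.
- rewrite -(mulr0 c); apply: cvgM; first exact: cvg_cst.
  rewrite gtr0_cvgV0; first exact: cvgr_idn.
  by near=> n; rewrite ltr0n; near: n; exact: nbhs_infty_gt.
Unshelve. all: by end_near. Qed.

(** The factor x * pdf x is the derivative of - s^2 * pdf. *)
Lemma normal_pdf_by_parts (n : nat) : (0 < n)%N ->
  (\int[mu]_(x in `[0%R, n%:R]) (x ^+ 2 * pdf x)%:E =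
   (s ^+ 2)%:E * \int[mu]_(x in `[0%R, n%:R]) (pdf x)%:E +
   (- s ^+ 2 * (n%:R * pdf n%:R))%:E)%E.
Proof.
move=> n0.
have cpdf := @continuous_normal_pdf R 0 s s0.
have dG (x : R) : is_derive x 1 (fun x => - s ^+ 2 * pdf x) (x * pdf x).
  have ? := is_derive_normal_pdf x.
  apply: is_derive_eq; rewrite /GRing.scale/=.
  by rewrite mulrA mulrNN mulrCA divff ?mulr1// gt_eqF.
have cG : continuous (fun x : R => - s ^+ 2 * pdf x).
  by move=> x; apply: cvgM; [exact: cvg_cst|exact: cpdf].
transitivity (\int[mu]_(x in `[0%R, n%:R]) (x * (x * pdf x))%:E)%E.
  by apply: eq_integral => x _; rewrite mulrA expr2.
rewrite (@integration_by_parts _ id (fun x => - s ^+ 2 * pdf x) (cst 1)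
  (fun x => x * pdf x)).
- rewrite mul0r subr0 addeC mulrCA; congr (_ + _)%E.
  under eq_integral do rewrite mul1r mulNr EFinN.
  rewrite integral_ge0N; last first.
    by move=> x _; rewrite lee_fin mulr_ge0 ?normal_pdf_ge0// ltW.
  rewrite oppeK; under eq_integral do rewrite EFinM.
  rewrite ge0_integralZl_EFin//.
  + by move=> x _; rewrite lee_fin normal_pdf_ge0.
  + by apply/measurable_funTS/measurable_EFinP; exact: measurable_normal_pdf.
  + exact: ltW.
- by rewrite ltr0n.
- by apply: continuous_subspaceT => x; exact: cvg_cst.
- split=> [x _|//|]; [exact: derivable_id| |].
  + by apply: cvg_at_right_filter; exact: cvg_id.
  + by apply: cvg_at_left_filter; exact: cvg_id.
- by move=> x _; rewrite derive1E derive_id.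
- by apply: continuous_subspaceT => x; apply: cvgM; [exact: cvg_id|exact: cpdf].
- split=> [x _| |]; first by have [] := dG x.
  + by apply: cvg_at_right_filter; exact: cG.
  + by apply: cvg_at_left_filter; exact: cG.
- by move=> x _; rewrite derive1E; have [_ ->] := dG x.
Qed.

(** Letting n go to infinity in [normal_pdf_by_parts] gives s^2 times the integral
    of the density over a half-line; both integrands are even. *)
Lemma normal_second_moment_pdf :
  (\int[mu]_x (x ^+ 2 * pdf x)%:E = (s ^+ 2)%:E)%E.
Proof.
have cpdf := @continuous_normal_pdf R 0 s s0.
have pdf0 x : 0 <= pdf x by exact: normal_pdf_ge0.
have pdf_even : pdf =1 pdf \o -%R.
  by move=> x; rewrite /= !normal_pdf0E sqrrN.
have cf : continuous (fun x : R => x ^+ 2 * pdf x).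
  by move=> x; apply: cvgM; [exact: sqr_continuous|exact: cpdf].
have f0 (x : R) : 0 <= x ^+ 2 * pdf x by rewrite mulr_ge0 ?sqr_ge0.
have half : (\int[mu]_(x in `[0%R, +oo[) (x ^+ 2 * pdf x)%:E =
    (s ^+ 2)%:E * \int[mu]_(x in `[0%R, +oo[) (pdf x)%:E)%E.
  have cvgf := @ge0_cvgn_integral R mu (fun x => x ^+ 2 * pdf x) f0
    (continuous_measurable_fun cf).
  have cvgp := @ge0_cvgn_integral R mu pdf pdf0
    (measurable_normal_pdf 0 s).
  have cvgt : (- s ^+ 2 * (n%:R * pdf n%:R))%:E @[n --> \oo] --> 0%E.
    apply: cvg_EFin; first exact: nearW.
    rewrite -[X in _ --> X](mulr0 (- s ^+ 2)).
    apply: cvgM; [exact: cvg_cst|]. exact: normal_pdf_tail.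
  rewrite -[RHS]adde0; apply: (cvg_unique _ cvgf) => //.
  apply: cvg_trans; last first.
    by apply: cvgeD cvgt; [rewrite fin_num_adde_defl|exact: (cvgeZl _ cvgp)].
  apply: near_eq_cvg; near=> n; rewrite -normal_pdf_by_parts//.
  by near: n; exact: nbhs_infty_gt.
rewrite (ge0_symfun_integralT f0 cf); last first.
  by move=> x /=; rewrite sqrrN; congr (_ * _); exact: pdf_even.
rewrite -set_itvcy half muleCA.
have := ge0_symfun_integralT pdf0 cpdf pdf_even.
by rewrite -set_itvcy integral_normal_pdf => <-; rewrite mule1.
Unshelve. all: by end_near. Qed.

End normal_second_moment.

(** * Measurability of random matrices *)

Section matrix_measurable.
Context d (T : measurableType d).

Lemma measurable_mxE d' (T' : measurableType d') (p q : nat)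
    (i : 'I_p) (j : 'I_q) :
  measurable_fun setT (fun M : 'M[T']_(p, q) => M i j).
Proof.
move=> _ B mB; rewrite setTI; apply: sub_sigma_algebra.
by exists (i, j) => //; exists B => //; rewrite setTI.
Qed.

Lemma measurable_fun_mx d' (T' : measurableType d') (p q : nat)
    (f : T -> 'M[T']_(p, q)) :
  (forall i j, measurable_fun setT (fun w => f w i j)) -> measurable_fun setT f.
Proof.
move=> mf; apply: measurability => // _ [B [[i j] _ [C mC <-]] <-].
rewrite !setTI -[X in measurable X]setTI.
exact: (mf i j measurableT C mC).
Qed.

Lemma measurable_det (R : realType) (m : nat) (f : T -> 'M[R]_m) :
  (forall i j, measurable_fun setT (fun w => f w i j)) ->
  measurable_fun setT (fun w => \det (f w)).
Proof.
move=> mf; apply: measurable_sum => s; apply: measurable_funM => //.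
by apply: measurable_prod => i _; exact: mf.
Qed.

End matrix_measurable.

(** * Covariances of multivariate normal vectors *)

Section quad_form_theory.
Context (K : comNzRingType) (r : nat).

Lemma quad_form_deltaD (A : 'M[K]_r) (a b : 'I_r) (t : K) :
  quad_form A (delta_mx a ord0 + t *: delta_mx b ord0) =
  A a a + t * A a b + t * A b a + t ^+ 2 * A b b.
Proof.
have E i j : (((delta_mx i ord0)^T *m A *m delta_mx j ord0) : 'M[K]_1) ord0 ord0
    = A i j.
  by rewrite trmx_delta -rowE -colE !mxE.
have trE : (delta_mx a ord0 + t *: delta_mx b ord0 : 'cV[K]_r)^T =
    (delta_mx a ord0)^T + t *: (delta_mx b ord0)^T.
  by rewrite linearD linearZ.
have add_mxE (M N : 'M[K]_1) : (M + N) ord0 ord0 = M ord0 ord0 + N ord0 ord0.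
  by rewrite mxE.
have scale_mxE u (M : 'M[K]_1) : (u *: M) ord0 ord0 = u * M ord0 ord0.
  by rewrite mxE.
rewrite /quad_form trE !mulmxDl !mulmxDr -!(scalemxAl, scalemxAr).
rewrite !add_mxE !scale_mxE !E.
by rewrite !addrA mulrA.
Qed.

End quad_form_theory.

Section second_moments.
Context d (T : measurableType d) (R : realType) (P : probability T R).

(** The case v = 0 is the point mass at 0, for which no density exists. *)
Lemma has_mean_sqr_centered_normal (v : R) (Y : T -> R) : 0 <= v ->
  measurable_fun setT Y ->
  (forall B, measurable B -> pushforward P Y B = centered_normal v B) ->
  has_mean P (fun w => Y w ^+ 2) v.
Proof.
move=> v0 mY lawY; apply: ge0_has_mean.
- exact: measurable_funX.
- by move=> w; exact: sqr_ge0.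
have msqr : measurable_fun setT (fun y : R => y ^+ 2) by exact: measurable_funX.
have [v_eq0|v_neq0] := eqVneq v 0.
  rewrite (@integral_eq_law _ _ _ _ _ R R P (dirac (0 : R)) Y id
    (fun y => (y ^+ 2)%:E))//.
  - rewrite integral_dirac//; last exact/measurable_EFinP.
    by rewrite diracE mem_set// mul1e expr0n/= v_eq0.
  - exact/measurable_EFinP.
  - by move=> B mB; rewrite -[LHS]/(pushforward P Y B) lawY// /centered_normal v_eq0 eqxx.
have s0 : Num.sqrt v != 0 by rewrite sqrtr_eq0 -ltNge lt_neqAle eq_sym v_neq0.
rewrite (@integral_eq_law _ _ _ _ _ R R P (normal_prob 0 (Num.sqrt v)) Y id
    (fun y => (y ^+ 2)%:E))//.
- rewrite -(@ge0_integral_density _ _ _ _ _ lebesgue_measure _ id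
    (normal_pdf 0 (Num.sqrt v)))//.
  + by rewrite normal_second_moment_pdf// sqr_sqrtr.
  + exact: measurable_normal_pdf.
  + by move=> y; exact: normal_pdf_ge0.
  + by move=> y; exact: sqr_ge0.
- exact/measurable_EFinP.
- move=> B mB; rewrite -[LHS]/(pushforward P Y B) lawY// /centered_normal.
  by rewrite (negPf v_neq0).
Qed.

(** Polarization: only the laws of linear forms of Y are given, and
    Y_a Y_b = ((Y_a + Y_b)^2 - (Y_a - Y_b)^2) / 4 expresses the product through
    the squares of two of them. *)
Lemma mvnormal_covariance (r : nat) (Sigma : 'M[R]_r) (Y : T -> 'cV[R]_r) :
  Sigma^T = Sigma -> (forall x, 0 <= quad_form Sigma x) ->
  measurable_fun setT Y -> mvnormal P Sigma Y ->
  forall a b, has_mean P (fun w => Y w a ord0 * Y w b ord0) (Sigma a b).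
Proof.
move=> symS posS mY lawY a b.
have mYE i : measurable_fun setT (fun w => Y w i ord0).
  exact: (measurableT_comp (measurable_mxE i ord0) mY).
pose sg (t : bool) : R := if t then 1 else -1.
pose x t : 'cV[R]_r := delta_mx a ord0 + sg t *: delta_mx b ord0.
have xE t w : ((x t)^T *m Y w) ord0 ord0 = Y w a ord0 + sg t * Y w b ord0.
  rewrite /x linearD linearZ/= mulmxDl -scalemxAl !trmx_delta -!rowE.
  by rewrite !mxE.
have mean_sqr t :
    has_mean P (fun w => ((x t)^T *m Y w) ord0 ord0 ^+ 2) (quad_form Sigma (x t)).
  apply: has_mean_sqr_centered_normal => //; last exact: lawY.
  under eq_fun do rewrite xE.
  by apply: measurable_funD => //; exact: measurable_funM.
have Sba : Sigma b a = Sigma a b by rewrite -[in LHS]symS mxE.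
rewrite (_ : Sigma a b = \sum_(t : bool) sg t / 4 * quad_form Sigma (x t)).
  rewrite (_ : (fun w => _) =
    (fun w => \sum_(t : bool) sg t / 4 * (((x t)^T *m Y w) ord0 ord0 ^+ 2))).
    by apply: has_mean_sum => t _; exact: has_meanZ.
  by apply/funext => w; rewrite big_bool/= !xE/=; field.
by rewrite big_bool/= !quad_form_deltaD /= Sba; field.
Qed.

End second_moments.

(** * The determinant of A B^T *)

Section determinant_expansion.
Context (K : comPzRingType) (m n : nat).

(** A form of the Cauchy-Binet formula in which the column sets are replaced by
    injective maps f. The terms of a non-injective f, with f i1 = f i2, add up
    to a multiple of the determinant of the matrix (i, k) |-> B(k, f i), whose
    rows i1 and i2 agree. *)
Lemma det_mulmx_trmx (A B : 'M[K]_(m, n)) :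
  \det (A *m B^T) = \sum_(f : {ffun 'I_m -> 'I_n} | injectiveb f)
    \sum_(s : 'S_m) (-1) ^+ s * \prod_i (A i (f i) * B (s i) (f i)).
Proof.
transitivity (\sum_(f : {ffun 'I_m -> 'I_n}) \sum_(s : 'S_m)
    (-1) ^+ s * \prod_i (A i (f i) * B (s i) (f i))).
  rewrite exchange_big/=; apply: eq_bigr => s _.
  rewrite -big_distrr/=; congr (_ * _).
  rewrite -(bigA_distr_bigA (fun i j => A i j * B (s i) j)).
  by apply: eq_bigr => i _; rewrite mxE; apply: eq_bigr => j _; rewrite mxE.
rewrite [LHS](bigID (fun f : {ffun 'I_m -> 'I_n} => injectiveb f))/=.
rewrite [X in _ + X]big1 ?addr0// => f /injectivePn[i1 [i2 i12 fi12]].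
rewrite (eq_bigr (fun s : 'S_m => (\prod_i A i (f i)) *
    ((-1) ^+ s * \prod_i (\matrix_(i, k) B k (f i)) i (s i)))); last first.
  move=> s _; rewrite mulrCA big_split/=; congr (_ * (_ * _)).
  by apply: eq_bigr => i _; rewrite mxE.
rewrite -big_distrr/= -/(\det _) (determinant_alternate i12) ?mulr0// => k.
by rewrite !mxE fi12.
Qed.

Lemma card_injective_ffun :
  #|[pred f : {ffun 'I_m -> 'I_n} | injectiveb f]| = (n ^_ m)%N.
Proof.
by have := card_inj_ffuns 'I_m 'I_n; rewrite !card_ord cardsE.
Qed.

End determinant_expansion.

(** * Minors of the Gram matrix of independent normal columns *)

Section gram_minors.
Context d (T : measurableType d) (R : realType) (P : probability T R).
Context (r n m : nat) (Sigma : 'M[R]_r) (X : T -> 'M[R]_(r, n)).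
Hypotheses (mX : measurable_fun setT X) (symS : Sigma^T = Sigma).
Hypothesis posS : forall x, 0 <= quad_form Sigma x.
Hypothesis indX : mutually_independent P (fun k w => col k (X w)).
Hypothesis lawX : forall k, mvnormal P Sigma (fun w => col k (X w)).

Let mcol k : measurable_fun setT (fun w => col k (X w)).
Proof.
apply: measurable_fun_mx => i j; under eq_fun do rewrite mxE.
exact: (measurableT_comp (measurable_mxE i k) mX).
Qed.

(** To apply independence over all n columns, the factors are grouped by column:
    since f is injective, each column receives one factor X(a i, f i) X(b i, f i)
    or the constant 1. *)
Lemma has_mean_prod_columns (f : 'I_m -> 'I_n) (a b : 'I_m -> 'I_r) :
  injective f ->
  has_mean P (fun w => \prod_i (X w (a i) (f i) * X w (b i) (f i)))
    (\prod_i Sigma (a i) (b i)).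
Proof.
move=> injf.
pose g k (y : 'cV[R]_r) := \prod_(i | f i == k) (y (a i) ord0 * y (b i) ord0).
pose e k := \prod_(i | f i == k) Sigma (a i) (b i).
have fiber k : (exists i, (fun j => f j == k) =1 pred1 i) \/
    (fun j => f j == k) =1 pred0.
  have [[i /eqP fi]|nf] := pselect (exists i, f i == k).
    by left; exists i => j /=; rewrite -fi (inj_eq injf).
  by right => j; apply/negP => fj; apply: nf; exists j.
rewrite (partition_big f predT)//= -/(e _).
rewrite (_ : (fun w => _) = (fun w => \prod_k g k (col k (X w)))); last first.
  apply/funext => w; rewrite (partition_big f predT)//=.
  by apply: eq_bigr => k _; apply: eq_bigr => i /eqP <-; rewrite !mxE.
apply: (independent_prod mcol indX) => k; rewrite /g /e.
  have [[i fi]|nf] := fiber k.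
    under eq_fun do rewrite (big_pred1 i)//.
    by apply: measurable_funM; exact: measurable_mxE.
  by under eq_fun do rewrite big_pred0//; exact: measurable_cst.
have [[i fi]|nf] := fiber k.
  rewrite (big_pred1 i)//; under eq_fun do rewrite (big_pred1 i)//.
  exact: mvnormal_covariance.
rewrite big_pred0//; under eq_fun do rewrite big_pred0//.
exact: has_mean_cst.
Qed.

(** Each injective f of the expansion contributes the same mean, the Leibniz sum
    of det(Sigma_{a x b}), and n ^_ m counts these f. *)
Lemma has_mean_minor_gram (a b : 'I_m -> 'I_r) :
  has_mean P (fun w => \det (mxsub a b (X w *m (X w)^T)))
    ((n ^_ m)%:R * \det (mxsub a b Sigma)).
Proof.
rewrite (_ : (fun w => _) = (fun w =>
    \sum_(f : {ffun 'I_m -> 'I_n} | injectiveb f) \sum_(s : 'S_m)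
      (-1) ^+ s * \prod_i (X w (a i) (f i) * X w (b (s i)) (f i)))); last first.
  apply/funext => w; rewrite mxsub_mul -trmx_mxsub det_mulmx_trmx.
  do 2 (apply: eq_bigr => ? _); congr (_ * _).
  by apply: eq_bigr => i _; rewrite !mxE.
rewrite (_ : _ * _ = \sum_(f : {ffun 'I_m -> 'I_n} | injectiveb f)
    \sum_(s : 'S_m) (-1) ^+ s * \prod_i Sigma (a i) (b (s i))); last first.
  rewrite sumr_const card_injective_ffun mulr_natl; congr (_ *+ _).
  by apply: eq_bigr => s _; congr (_ * _); apply: eq_bigr => i _; rewrite mxE.
apply: has_mean_sum => f /injectiveP injf; apply: has_mean_sum => s _.
by apply: has_meanZ; exact: (has_mean_prod_columns a (b \o s) injf).
Qed.

End gram_minors.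

(** * Minors of Wishart matrices *)

Lemma wishart_expectation_minor d (T : measurableType d) (R : realType)
    (P : probability T R) (r n m : nat) (Sigma : 'M[R]_r)
    (W : {RV P >-> 'M[R]_r}) (a b : 'I_m -> 'I_r) :
  Sigma^T = Sigma -> (forall x, 0 <= quad_form Sigma x) ->
  wishart n Sigma (distribution P W) ->
  ('E_P[fun w => \det (mxsub a b (W w))] =
   ((n ^_ m)%:R * \det (mxsub a b Sigma))%:E)%E.
Proof.
move=> symS posS [d' [T' [P' [X [indX lawX lawW]]]]].
have mX := measurable_funPT X.
have [_ <-] := has_mean_minor_gram mX symS posS indX lawX a b.
rewrite unlock.
apply: (@integral_eq_law _ _ _ _ _ _ _ P P' W (fun w => X w *m (X w)^T)
  (fun M => (\det (mxsub a b M))%:E)).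
- exact: measurable_funPT.
- apply: measurable_fun_mx => i j; under eq_fun do rewrite mxE.
  apply: measurable_sum => k; under eq_fun do rewrite mxE.
  apply: measurable_funM.
    exact: (measurableT_comp (measurable_mxE i k) mX).
  exact: (measurableT_comp (measurable_mxE j k) mX).
- apply/measurable_EFinP; apply: measurable_det => i j.
  by under eq_fun do rewrite mxE; exact: measurable_mxE.
- by move=> B mB; exact: lawW.
Qed.

Lemma ffact_ratio (K : numFieldType) (n m : nat) : (m <= n)%N ->
  (n ^_ m)%:R = n`!%:R / (n - m)`!%:R :> K.
Proof.
by move=> lemn; rewrite -(ffact_fact lemn) natrM mulfK// pnatr_eq0 -lt0n fact_gt0.
Qed.

Lemma msubset_nth_inj (r m : nat) (I : msubset r m) : injective (msubset_nth I).
Proof. by move=> i j /enum_val_inj/cast_ord_inj. Qed.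

Lemma msubset_nthP (r m : nat) (I : msubset r m) (x : 'I_r) :
  reflect (exists i, msubset_nth I i = x) (x \in val I).
Proof.
apply: (iffP idP) => [xI|[i <-]]; last exact: enum_valP.
exists (cast_ord (eqP (valP I)) (enum_rank_in xI x)).
by rewrite /msubset_nth cast_ordK enum_rankK_in.
Qed.

(** If I <> J, some element of I is not in J, since the two sets have the same
    cardinality; the corresponding row of the minor is zero. *)
Lemma det_msubmx1 (K : comNzRingType) (r m : nat) (I J : msubset r m) :
  \det (msubmx (1%:M : 'M[K]_r) I J) = (I == J)%:R.
Proof.
have [<-|IJ] := eqVneq I J.
  rewrite -[RHS](det1 K m); congr (\det _); apply/matrixP => i j.
  by rewrite !mxE (inj_eq (@msubset_nth_inj _ _ I)).
have /subsetPn[x /msubset_nthP[i <-] iJ] : ~~ (val I \subset val J).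
  apply: contra IJ => subIJ.
  by rewrite -val_eqE eqEcard subIJ (eqP (valP I)) (eqP (valP J)) leqnn.
rewrite (expand_det_row _ i) big1// => j _.
rewrite !mxE (_ : _ == _ = false) ?mul0r//.
by apply: contraNF iJ => /eqP ->; apply/msubset_nthP; exists j.
Qed.

Lemma quad_form1_ge0 (R : realDomainType) (r : nat) (x : 'cV[R]_r) :
  0 <= quad_form 1%:M x.
Proof.
by rewrite /quad_form mulmx1 mxE sumr_ge0// => i _; rewrite mxE -expr2 sqr_ge0.
Qed.

Lemma sym_posdef_ge0 (R : numDomainType) (r : nat) (A : 'M[R]_r) :
  sym_posdef A -> forall x, 0 <= quad_form A x.
Proof.
move=> [_ posA] x; have [->|/posA/ltW//] := eqVneq x 0.
by rewrite /quad_form mulmx0 mxE.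
Qed.

Theorem corollary4p2 (R : realType) (r m n : nat)
    (hr : (1 <= r)%N) (hm : (1 <= m <= r)%N) (hn : (m <= n)%N)
    (d : measure_display) (T : measurableType d) (P : probability T R) :
  (forall (I J : msubset r m) (W : {RV P >-> 'M[R]_r}),
     wishart n 1%:M (distribution P W) ->
     ('E_P[fun w => \det (msubmx (W w) I J)])%E =
       (if I == J then n`!%:R / (n - m)`!%:R else 0)%:E)
  /\
  (forall (Sigma : 'M[R]_r) (S : {RV P >-> 'M[R]_r}),
     sym_posdef Sigma ->
     wishart n Sigma (distribution P S) ->
     expectation_mx P (fun w => compound m (S w)) =
       map_mx EFin ((n`!%:R / (n - m)`!%:R) *: compound m Sigma)).
Proof.
split=> [I J W wW|Sigma S posS wS].
  rewrite (wishart_expectation_minor _ _ _ _ wW); last 2 first.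
  - exact: trmx1.
  - exact: quad_form1_ge0.
  rewrite -/(msubmx _ I J) det_msubmx1 ffact_ratio//.
  by case: (I == J); rewrite ?mulr1 ?mulr0.
apply/matrixP => k l; rewrite !mxE.
under [X in 'E_P[X]%E]eq_fun do rewrite mxE.
rewrite (wishart_expectation_minor _ _ posS.1 (sym_posdef_ge0 posS) wS).
by rewrite ffact_ratio.
Qed.
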